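(* Let $\mathbf{A}$ be a countable weakly oligomorphic relational structure. Then $\mathbf{A}$ is homomorphism-equivalent to a structure $\mathbf{F}$ which is finite or $\omega$-categorical. Moreover, $\mathbf{F}$ embeds into $\mathbf{A}$.
   Context: Relational structures have signatures with only relation symbols (any cardinality); ''countable'' means finite or countably infinite. A positive existential type in $x_1,\dots,x_n$ is a set of positive existential formulas with free variables among $x_1,\dots,x_n$, defining the intersection of the relations defined by its members; $\mathbf{A}$ is weakly oligomorphic if for each $n$ only finitely many $n$-ary relations are definable by such types. Two structures are homomorphism-equivalent if there are homomorphisms in both directions. A countably infinite structure is $\omega$-categorical if its complete first-order theory has, up to isomorphism, exactly one countably infinite model. *)

(* Defs.v *)
From mathcomp Require Import all_boot.
From mathcomp Require Import classical_sets functions cardinality.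

Set Implicit Arguments.
Unset Strict Implicit.
Unset Printing Implicit Defensive.

Local Open Scope classical_set_scope.
Local Open Scope card_scope.

Record signature : Type := Signature {
  symbol :> Type;
  arity : symbol -> nat }.

Record structure (L : signature) : Type := Structure {
  carrier :> Type;
  interp : forall r : L, set ((arity r).-tuple carrier) }.

Arguments interp {L} A r : rename.

(* [formula L n] is the type of first-order formulas whose free variables are  *)
(* among n given ones, indexed by 'I_n. A quantifier binds index 0 of its      *)
(* body and shifts the other variables by one.                                 *)
Inductive formula (L : signature) (n : nat) : Type :=
| FEq of 'I_n & 'I_n
| FRel (r : L) of (arity r).-tuple 'I_n
| FNot of formula L n
| FAnd of formula L n & formula L n
| FOr of formula L n & formula L n
| FEx of formula L n.+1
| FAll of formula L n.+1.

Notation sentence L := (formula L 0).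

Fixpoint sat (L : signature) (A : structure L) (n : nat) (e : n.-tuple A)
    (phi : formula L n) {struct phi} : Prop :=
  match phi with
  | FEq i j => tnth e i = tnth e j
  | FRel r v => interp A r (map_tuple (tnth e) v)
  | FNot psi => ~ sat e psi
  | FAnd psi chi => sat e psi /\ sat e chi
  | FOr psi chi => sat e psi \/ sat e chi
  | FEx psi => exists a : A, sat (cons_tuple a e) psi
  | FAll psi => forall a : A, sat (cons_tuple a e) psi
  end.

Arguments sat {L} A {n} e phi.

Definition satisfies (L : signature) (A : structure L) (phi : sentence L) : Prop :=
  sat A [tuple] phi.

Fixpoint positive_existential (L : signature) (n : nat) (phi : formula L n)
    {struct phi} : bool :=
  match phi with
  | FEq _ _ => true
  | FRel _ _ => true
  | FNot _ => false
  | FAnd psi chi => positive_existential psi && positive_existential chi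
  | FOr psi chi => positive_existential psi && positive_existential chi
  | FEx psi => positive_existential psi
  | FAll _ => false
  end.

Definition formula_relation (L : signature) (A : structure L) (n : nat)
    (phi : formula L n) : set (n.-tuple A) :=
  [set t | sat A t phi].

Arguments formula_relation {L} A {n} phi.

Definition positive_existential_type (L : signature) (n : nat)
    (p : set (formula L n)) : Prop :=
  forall phi, p phi -> positive_existential phi.

Definition type_relation (L : signature) (A : structure L) (n : nat)
    (p : set (formula L n)) : set (n.-tuple A) :=
  \bigcap_(phi in p) formula_relation A phi.

Arguments type_relation {L} A {n} p.

Definition weakly_oligomorphic (L : signature) (A : structure L) : Prop :=
  forall n : nat,
    finite_set [set type_relation A p | p in @positive_existential_type L n].

Definition countable_structure (L : signature) (A : structure L) : Prop :=
  countable [set: A].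

Definition finite_structure (L : signature) (A : structure L) : Prop :=
  finite_set [set: A].

Definition countably_infinite (L : signature) (A : structure L) : Prop :=
  [set: A] #= [set: nat].

Definition homomorphism (L : signature) (A B : structure L) (h : A -> B) : Prop :=
  forall (r : L) (t : (arity r).-tuple A),
    interp A r t -> interp B r (map_tuple h t).

Definition homomorphism_equivalent (L : signature) (A B : structure L) : Prop :=
  (exists h : A -> B, homomorphism h) /\ (exists g : B -> A, homomorphism g).

Definition embedding (L : signature) (A B : structure L) (h : A -> B) : Prop :=
  injective h /\
  forall (r : L) (t : (arity r).-tuple A),
    interp A r t <-> interp B r (map_tuple h t).

Definition embeds (L : signature) (A B : structure L) : Prop :=
  exists h : A -> B, embedding h.

Definition isomorphic (L : signature) (A B : structure L) : Prop :=
  exists h : A -> B, bijective h /\ embedding h.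

Definition theory (L : signature) (A : structure L) : set (sentence L) :=
  [set phi | satisfies A phi].

Definition model (L : signature) (T : set (sentence L)) (M : structure L) : Prop :=
  forall phi, T phi -> satisfies M phi.

Definition omega_categorical (L : signature) (A : structure L) : Prop :=
  countably_infinite A /\
  exists M : structure L,
    [/\ countably_infinite M, model (theory A) M &
        forall N : structure L,
          countably_infinite N -> model (theory A) N -> isomorphic N M].

(* Main.v *)
(* Order tuples of A of a given length by inclusion of their positive          *)
(* existential types. Weak oligomorphy makes each type principal, so           *)
(* tp(a) <= tp(b) lifts to one-point extensions, and puts every tuple below    *)
(* one of maximal type. By extending maximal tuples one point at a time, one   *)
(* obtains a sequence f in A with all initial segments maximal, such that for  *)
(* every x in A infinitely many s satisfy                                      *)
(*   tp(x, f_0, ..., f_(s-1)) <= tp(f_s, f_0, ..., f_(s-1)).                   *)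
(* Then F := range f receives a homomorphism from A (go forth only), and two   *)
(* tuples of F with comparable, hence equal, types in A are matched by a       *)
(* back-and-forth system inside F, so they satisfy the same first-order        *)
(* formulas in F. Therefore F has finitely many first-order definable          *)
(* relations of each arity, which gives omega-categoricity when F is infinite. *)

Require Import Defs.
From mathcomp Require Import all_boot.
From mathcomp Require Import boolp classical_sets functions cardinality.

Set Implicit Arguments.
Unset Strict Implicit.
Unset Printing Implicit Defensive.

(** Finiteness lets one formula carry a whole positive existential type. Hence an inclusion of types
    survives adding a point ([pe_le_extend]), and a tuple of maximal type can be lengthened to
    another one lying above any prescribed extension ([pe_maximal_extend]). Maximality passes to
    subtuples ([pe_maximal_subtuple]), so the range of the generic sequence is a [pe_core]. There
    inclusion of types is symmetric, which turns forth into back-and-forth ([core_sat]) and leaves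
    finitely many definable relations; a Ryll-Nardzewski argument concludes
    ([omega_categorical_of_finitely_many_relations]). *)

(** * Representatives, enumerations and dependent choice *)

Lemma finite_image_representatives (T U : Type) (D : set T) (f : T -> U) :
  finite_set (f @` D)%classic ->
  exists (I : finType) (g : I -> T),
    (forall i, D (g i)) /\ forall x, D x -> exists i, f (g i) = f x.
Proof.
move=> fin; have [s sE] := (finite_seqP ((f @` D)%classic : set {classic U})).1 fin.
have /choice[g gP] (i : seq_sub s) : exists x, D x /\ f x = ssval i.
  have : (f @` D)%classic (ssval i) by rewrite sE; exact: ssvalP.
  by case=> x Dx fx; exists x.
exists (seq_sub s), g; split=> [i|x Dx]; first by case: (gP i).
have sx : f x \in (s : seq {classic U}).
  have : (f @` D)%classic (f x) by exists x.
  by rewrite sE.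
by exists (SeqSub sx); case: (gP (SeqSub sx)).
Qed.

Lemma countable_enumeration (T : Type) (x0 : T) :
  countable [set: T]%classic ->
  exists u : nat -> T, forall x, exists k, u k = x.
Proof.
move=> /pcard_leTP/unsquash f.
have /choice[u uP] (k : nat) : exists x : T, forall y, f y = k -> y = x.
  have [[y fy]|no] := pselect (exists y, f y = k).
    by exists y => z fz; apply: (@inj _ _ _ f); rewrite ?inE // fz fy.
  by exists x0 => y fy; case: no; exists y.
by exists u => x; exists (f x); rewrite -(uP _ x).
Qed.

Lemma recurrent_enumeration (T : Type) (u : nat -> T) :
  (forall x, exists k, u k = x) ->
  exists e : nat -> T, forall x N, exists2 s, N <= s & e s = x.
Proof.
(* The exponent of 2 in [s] is the index: [2 ^ k * 3 ^ N] has exponent [k] and is at least [N]. *)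
move=> uP; exists (fun s => u (logn 2 s)) => x N.
have [k <-] := uP x; exists (2 ^ k * 3 ^ N).
  rewrite (leq_trans (ltnW (ltn_expl N (isT : 1 < 3)))) //.
  by rewrite leq_pmull // expn_gt0.
by rewrite lognM ?expn_gt0 // pfactorK // lognX muln0 addn0.
Qed.

(* The most recent value comes first: [prefix f n] is (f (n-1), ..., f 0). *)
Fixpoint prefix (T : Type) (f : nat -> T) (n : nat) : n.-tuple T :=
  if n is m.+1 then cons_tuple (f m) (prefix f m) else [tuple].

Lemma tnth_prefix (T : Type) (f : nat -> T) n (i : 'I_n) :
  tnth (prefix f n) i = f (n - i.+1).
Proof.
elim: n i => [[]//|n IH] i /=.
case: (unliftP ord0 i) => [j|] ->; last by rewrite tnth0 subn1.
by rewrite tnthS IH subSS.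
Qed.

Lemma tnth_prefix_inord (T : Type) (f : nat -> T) n k : k <= n ->
  tnth (prefix f n.+1) (rev_ord (inord k)) = f k.
Proof.
by move=> kn; rewrite tnth_prefix /= inordK // subnSK ?ltnS // subKn // ltnW.
Qed.

Lemma map_prefix (T U : Type) (h : T -> U) (f : nat -> T) n :
  map_tuple h (prefix f n) = prefix (h \o f) n.
Proof. by apply: eq_from_tnth => i; rewrite tnth_map !tnth_prefix. Qed.

Lemma map_cons_tuple (T U : Type) (h : T -> U) n (x : T) (t : n.-tuple T) :
  map_tuple h (cons_tuple x t) = cons_tuple (h x) (map_tuple h t).
Proof. exact: val_inj. Qed.

(** [P] is the invariant of a stagewise construction and [R] the task met at stage [n]. *)
Lemma dependent_choice_prefix (T : Type) (P : forall n, n.-tuple T -> Prop)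
    (R : forall n, n.-tuple T -> T -> Prop) :
  P 0 [tuple] ->
  (forall n (t : n.-tuple T), P n t -> exists d, P n.+1 (cons_tuple d t) /\ R n t d) ->
  exists f : nat -> T, forall n, P n (prefix f n) /\ R n (prefix f n) (f n).
Proof.
move=> P0 step.
have /choice[d dP] (w : {n : nat & {t : n.-tuple T | P n t}}) : exists d,
    P (tag w).+1 (cons_tuple d (sval (tagged w))) /\ R (tag w) (sval (tagged w)) d.
  by case: w => n [t Pt]; exact: step.
pose st := fix st n : {t : n.-tuple T | P n t} :=
  if n is m.+1 then let w := Tagged (fun n => {t : n.-tuple T | P n t}) (st m) in
    exist (P m.+1) (cons_tuple (d w) (sval (st m))) (dP w).1
  else exist (P 0) [tuple] P0.
pose f n := d (Tagged (fun n => {t : n.-tuple T | P n t}) (st n)).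
have fE n : prefix f n = sval (st n) by elim: n => //= n ->.
exists f => n; rewrite fE; split; first by case: (st n).
exact: (dP (Tagged (fun n => {t : n.-tuple T | P n t}) (st n))).2.
Qed.

(** * Renaming of variables, conjunctions and universal closures *)

Section Formulas.
Variable L : signature.
Implicit Types A B M N F : structure L.

Definition lift_renaming n m (rho : 'I_n -> 'I_m) (i : 'I_n.+1) : 'I_m.+1 :=
  if unlift ord0 i is Some j then lift ord0 (rho j) else ord0.

Fixpoint rename n (phi : formula L n) m (rho : 'I_n -> 'I_m) {struct phi} :
    formula L m :=
  match phi with
  | FEq i j => FEq L (rho i) (rho j)
  | FRel r v => FRel (map_tuple rho v)
  | FNot psi => FNot (rename psi rho)
  | FAnd psi chi => FAnd (rename psi rho) (rename chi rho)
  | FOr psi chi => FOr (rename psi rho) (rename chi rho)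
  | FEx psi => FEx (rename psi (lift_renaming rho))
  | FAll psi => FAll (rename psi (lift_renaming rho))
  end.

Lemma positive_existential_rename n (phi : formula L n) m (rho : 'I_n -> 'I_m) :
  positive_existential (rename phi rho) = positive_existential phi.
Proof.
by elim: phi m rho => //= {}n p IHp q IHq m rho; rewrite IHp IHq.
Qed.

Definition subtuple (T : Type) n m (t : m.-tuple T) (rho : 'I_n -> 'I_m) :
  n.-tuple T := [tuple tnth t (rho i) | i < n].

Lemma tnth_subtuple (T : Type) n m (t : m.-tuple T) (rho : 'I_n -> 'I_m) i :
  tnth (subtuple t rho) i = tnth t (rho i).
Proof. exact: tnth_mktuple. Qed.

Lemma subtuple_cons (T : Type) n m (x : T) (t : m.-tuple T) (rho : 'I_n -> 'I_m) :
  subtuple (cons_tuple x t) (lift_renaming rho) = cons_tuple x (subtuple t rho).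
Proof.
apply: eq_from_tnth => i; rewrite tnth_subtuple /lift_renaming.
by case: (unliftP ord0 i) => [j|] ->; rewrite ?tnth0 // !tnthS tnth_subtuple.
Qed.

Lemma sat_rename A n (phi : formula L n) m (rho : 'I_n -> 'I_m) (t : m.-tuple A) :
  sat A t (rename phi rho) <-> sat A (subtuple t rho) phi.
Proof.
elim: phi m rho t => {n} /=.
- by move=> n i j m rho t; rewrite !tnth_subtuple.
- move=> n r v m rho t.
  suff -> : map_tuple (tnth t) (map_tuple rho v) =
    map_tuple (tnth (subtuple t rho)) v by [].
  by apply: eq_from_tnth => i; rewrite !tnth_map tnth_ord_tuple.
- by move=> n p IHp m rho t; rewrite IHp.
- by move=> n p IHp q IHq m rho t; rewrite IHp IHq.
- by move=> n p IHp q IHq m rho t; rewrite IHp IHq.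
- by move=> n p IHp m rho t; split=> -[a] H; exists a; move: H;
    rewrite IHp subtuple_cons.
- by move=> n p IHp m rho t; split=> H a; move: (H a);
    rewrite IHp subtuple_cons.
Qed.

(** [FEq L ord0 ord0] plays the role of truth, so at least one variable must be available. *)
Definition conjunction n (I : Type) (s : seq I) (g : I -> formula L n.+1) :=
  foldr (fun i phi => FAnd (g i) phi) (FEq L ord0 ord0) s.

Lemma sat_conjunction A n (I : eqType) (s : seq I) (g : I -> formula L n.+1)
    (t : n.+1.-tuple A) :
  sat A t (conjunction s g) <-> forall i, i \in s -> sat A t (g i).
Proof.
elim: s => [|i s IH] /=; first by split.
rewrite IH; split=> [[Hi Hs] j|H].
  by rewrite inE => /predU1P[->|/Hs].
by split=> [|j js]; apply: H; rewrite inE ?eqxx ?js ?orbT.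
Qed.

Lemma positive_existential_conjunction n (I : Type) (s : seq I)
    (g : I -> formula L n.+1) :
  (forall i, positive_existential (g i)) -> positive_existential (conjunction s g).
Proof. by move=> gP; elim: s => //= i s ->; rewrite gP. Qed.

Fixpoint universal_closure n : formula L n -> sentence L :=
  if n is m.+1 then fun phi => universal_closure (FAll phi) else id.

Lemma satisfies_universal_closure A n (phi : formula L n) :
  satisfies A (universal_closure phi) <-> forall t, sat A t phi.
Proof.
elim: n phi => [|n IH] phi /=.
  by split=> [H t|]; [rewrite tuple0|exact].
rewrite IH; split=> [H t|H t a]; last exact: H.
by rewrite (tuple_eta t); exact: (H (behead_tuple t)).
Qed.

(** * Comparison of types, back-and-forth and omega-categoricity *)

Definition pe_le A B n (a : n.-tuple A) (b : n.-tuple B) :=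
  forall phi : formula L n, positive_existential phi -> sat A a phi -> sat B b phi.

Lemma pe_le_trans A B M n (b : n.-tuple B) (a : n.-tuple A) (c : n.-tuple M) :
  pe_le a b -> pe_le b c -> pe_le a c.
Proof. by move=> ab bc phi pe /ab-/(_ pe)/bc; apply. Qed.

Lemma pe_le_subtuple A B n m (a : m.-tuple A) (b : m.-tuple B) (rho : 'I_n -> 'I_m) :
  pe_le a b -> pe_le (subtuple a rho) (subtuple b rho).
Proof.
move=> ab phi pe; rewrite -!sat_rename; apply: ab.
by rewrite positive_existential_rename.
Qed.

Lemma pe_le_tail A B n c d (a : n.-tuple A) (b : n.-tuple B) :
  pe_le (cons_tuple c a) (cons_tuple d b) -> pe_le a b.
Proof.
have E (T : Type) (x : T) (t : n.-tuple T) :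
    t = subtuple (cons_tuple x t) (lift ord0).
  by apply: eq_from_tnth => i; rewrite tnth_subtuple tnthS.
by rewrite {2}(E _ c a) {2}(E _ d b); exact: pe_le_subtuple.
Qed.

(** Sending [u k] to [v k] is well defined because equality atoms are preserved, and a homomorphism
    because every tuple lies in a long enough prefix. *)
Lemma homomorphism_of_prefixes A B (u : nat -> A) (v : nat -> B) :
  (forall x, exists k, u k = x) ->
  (forall n, pe_le (prefix u n) (prefix v n)) ->
  exists h : A -> B, homomorphism h /\ forall k, h (u k) = v k.
Proof.
move=> /choice[k uk] uv; exists (v \o k); split=> [r t At|j] /=; last first.
  pose n := maxn (k (u j)) j.
  have := uv n.+1 (FEq L (rev_ord (inord (k (u j)))) (rev_ord (inord j))) isT.
  by rewrite /= !tnth_prefix_inord ?leq_maxl ?leq_maxr // uk; apply.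
pose n := \max_(i < arity r) k (tnth t i).
have kn i : k (tnth t i) <= n by exact: leq_bigmax.
have := uv n.+1 (FRel (map_tuple (fun x => rev_ord (inord (k x))) t)) isT.
rewrite /=.
have -> : map_tuple (tnth (cons_tuple (u n) (prefix u n)))
   (map_tuple (fun x => rev_ord (inord (k x))) t) = t.
  by apply: eq_from_tnth => i; rewrite !tnth_map (tnth_prefix_inord u (kn i)) uk.
move=> /(_ At); congr (interp B r _).
by apply: eq_from_tnth => i; rewrite !tnth_map (tnth_prefix_inord v (kn i)).
Qed.

Definition fo_equiv A B n (a : n.-tuple A) (b : n.-tuple B) :=
  forall phi : formula L n, sat A a phi <-> sat B b phi.

(** The finitely many [g i], each negated where it fails at [c], form one formula isolating the type
    of [c] over [a]; its existential closure transfers to [b]. *)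
Lemma fo_equiv_extend A B n (I : finType) (g : I -> formula L n.+1)
    (a : n.-tuple A) (b : n.-tuple B) (c : A) :
  (forall phi, exists i, (forall t, sat A t (g i) <-> sat A t phi) /\
                         (forall t, sat B t (g i) <-> sat B t phi)) ->
  fo_equiv a b -> exists d, fo_equiv (cons_tuple c a) (cons_tuple d b).
Proof.
move=> gP ab.
pose lit i := if `[< sat A (cons_tuple c a) (g i) >] then g i else FNot (g i).
have : sat A a (FEx (conjunction (enum I) lit)).
  exists c; apply/sat_conjunction => i _; rewrite /lit.
  by case: asboolP.
move=> /ab[d /sat_conjunction dP]; exists d => phi.
have [i [<- <-]] := gP phi.
have := dP i (mem_enum _ i); rewrite /lit.
by case: asboolP => // ? ?; split.
Qed.

Lemma isomorphic_of_prefixes A B (u : nat -> A) (v : nat -> B) :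
  (forall x, exists k, u k = x) -> (forall y, exists k, v k = y) ->
  (forall n, fo_equiv (prefix u n) (prefix v n)) -> isomorphic A B.
Proof.
move=> us vs uv.
have [h [hh hE]] : exists h : A -> B, homomorphism h /\ forall k, h (u k) = v k.
  by apply: homomorphism_of_prefixes => // n phi _ /uv.
have [g [gh gE]] : exists g : B -> A, homomorphism g /\ forall k, g (v k) = u k.
  by apply: homomorphism_of_prefixes => // n phi _ /uv.
have hK : cancel h g by move=> x; have [k <-] := us x; rewrite hE gE.
have gK : cancel g h by move=> x; have [k <-] := vs x; rewrite gE hE.
exists h; split; first by exists g.
split=> [|r t]; first exact: can_inj hK.
split=> [|/gh]; first exact: hh.
by congr (interp A r _); apply: eq_from_tnth => i; rewrite !tnth_map hK.
Qed.

(** Equivalence of two formulas in [F] is a sentence of its theory, so representatives for [F] also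
    serve in [N], and [fo_equiv_extend] runs a back-and-forth. *)
Lemma omega_categorical_of_finitely_many_relations F :
  countably_infinite F ->
  (forall n, finite_set [set formula_relation F phi | phi in @setT (formula L n)]%classic) ->
  omega_categorical F.
Proof.
move=> Finf fin; split=> //; exists F; split=> // N Ninf NF.
have enum_of (M : structure L) : countably_infinite M ->
    exists u : nat -> M, forall x, exists k, u k = x.
  move=> /card_set_bijP[h [_ hinj hsurj]].
  have /choice[u hu] (k : nat) : exists x, h x = k.
    by have [x _] := hsurj k Logic.I; exists x.
  by exists u => x; exists (h x); apply: hinj; rewrite ?inE.
have [uN uNs] := enum_of _ Ninf; have [uF uFs] := enum_of _ Finf.
have reps n : exists (I : finType) (g : I -> formula L n), forall phi, exists i,
    (forall t, sat N t (g i) <-> sat N t phi) /\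
    (forall t, sat F t (g i) <-> sat F t phi).
  have [I [g [_ gP]]] := finite_image_representatives (fin n).
  exists I, g => phi; have [i giE] := gP phi Logic.I; exists i.
  have giF t : sat F t (g i) <-> sat F t phi.
    by rewrite -[sat F t phi]/(formula_relation F phi t) -giE.
  split=> // t.
  pose iff := FAnd (FOr (FNot (g i)) phi) (FOr (FNot phi) (g i)).
  have : satisfies N (universal_closure iff).
    apply: NF; apply/satisfies_universal_closure => s /=.
    by rewrite giF; have [?|?] := pselect (sat F s phi); split; [right|right|left|left].
  by move=> /satisfies_universal_closure/(_ t) /= [[?|?] [?|?]]; split.
pose P n (t : n.-tuple (N * F)) :=
  fo_equiv (map_tuple fst t) (map_tuple snd t).
(* Odd stages exhaust [N], even stages exhaust [F]. *)
pose R n (t : n.-tuple (N * F)) (d : N * F) :=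
  if odd n then d.1 = uN n./2 else d.2 = uF n./2.
have [f fP] : exists f : nat -> N * F,
    forall n, P n (prefix f n) /\ R n (prefix f n) (f n).
  apply: dependent_choice_prefix => [phi|n t Pt].
    rewrite [map_tuple _ _]tuple0 [map_tuple snd _]tuple0.
    split=> [Nphi|Fphi]; last exact: NF.
    by apply: contrapT => nF; exact: (NF (FNot phi) nF).
  have [I [g gP]] := reps n.+1.
  rewrite /R; case: (odd n).
    have [d dP] := fo_equiv_extend (uN n./2) gP Pt.
    by exists (uN n./2, d); split=> //; rewrite /P !map_cons_tuple.
  have gP' phi : exists i, (forall t, sat F t (g i) <-> sat F t phi) /\
      (forall t, sat N t (g i) <-> sat N t phi).
    by have [i []] := gP phi; exists i.
  have Pt' : fo_equiv (map_tuple snd t) (map_tuple fst t) by move=> phi; rewrite Pt.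
  have [d dP] := fo_equiv_extend (uF n./2) gP' Pt'.
  by exists (d, uF n./2); split=> //; rewrite /P !map_cons_tuple => phi; rewrite dP.
apply: (@isomorphic_of_prefixes _ _ (fst \o f) (snd \o f)) => [x|y|n].
- have [k <-] := uNs x; exists k.*2.+1.
  by have [_] := fP k.*2.+1; rewrite /R /= odd_double /= uphalf_double.
- have [k <-] := uFs y; exists k.*2.
  by have [_] := fP k.*2; rewrite /R /= odd_double doubleK.
- by have [] := fP n; rewrite /P !map_prefix.
Qed.

(** * Extension and maximality of types under weak oligomorphy *)

Lemma positive_existential_representatives A n :
  weakly_oligomorphic A ->
  exists (I : finType) (g : I -> formula L n),
    (forall i, positive_existential (g i)) /\
    forall phi, positive_existential phi ->
      exists i, forall t, sat A t (g i) <-> sat A t phi.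
Proof.
move=> /(_ n) fin.
have [|I [g [gpe gP]]] := @finite_image_representatives _ _
    (fun phi : formula L n => positive_existential phi) (formula_relation A).
  apply: sub_finite_set fin => _ [phi pe <-].
  exists [set phi]%classic; first by move=> _ ->.
  by rewrite /type_relation bigcap_set1.
exists I, g; split=> // phi /gP[i giE]; exists i => t.
by rewrite -[sat A t phi]/(formula_relation A phi t) -giE.
Qed.

Section WeaklyOligomorphic.
Variable A : structure L.
Hypothesis A_wo : weakly_oligomorphic A.

(** The conjunction of the representatives true at [c], quantified over its first variable, is
    positive existential and true of [a], hence of [b]; any witness is [d]. *)
Lemma pe_le_extend n (a b : n.-tuple A) (c : A) :
  pe_le a b -> exists d, pe_le (cons_tuple c a) (cons_tuple d b).
Proof.
have [I [g [gpe gP]]] := positive_existential_representatives n.+1 A_wo.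
pose s := [seq i <- enum I | `[< sat A (cons_tuple c a) (g i) >]].
move=> /(_ (FEx (conjunction s g)))[].
- exact: positive_existential_conjunction.
- exists c; apply/sat_conjunction => i.
  by rewrite mem_filter => /andP[/asboolP].
- move=> d /sat_conjunction dP; exists d => phi /gP[i giE] /giE gi.
  by apply/giE/dP; rewrite mem_filter mem_enum andbT; exact/asboolP.
Qed.

Lemma pe_le_extend_tuple n (a b : n.-tuple A) m (c : m.-tuple A) :
  pe_le a b -> exists d : m.-tuple A, pe_le (cat_tuple c a) (cat_tuple d b).
Proof.
move=> ab; elim: m c => [|m IH] c.
  exists [tuple]; rewrite (tuple0 c).
  have E (t : n.-tuple A) : cat_tuple [tuple] t = t by exact: val_inj.
  by rewrite !E.
have [d /(pe_le_extend (thead c))[x xP]] := IH (behead_tuple c).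
exists (cons_tuple x d); rewrite (tuple_eta c).
have E y (t : m.-tuple A) (s : n.-tuple A) :
  cat_tuple (cons_tuple y t) s = cons_tuple y (cat_tuple t s) by exact: val_inj.
by rewrite [cat_tuple [tuple of _] _]E E.
Qed.

Definition pe_maximal n (a : n.-tuple A) :=
  forall b : n.-tuple A, pe_le a b -> pe_le b a.

Lemma pe_maximal_le n (a b : n.-tuple A) :
  pe_le a b -> pe_maximal a -> pe_maximal b.
Proof.
by move=> ab amax c bc; apply: (pe_le_trans _ ab); apply/amax/(pe_le_trans ab bc).
Qed.

(** A type is encoded by a subset of a finite set; a tuple above [a] whose subset is largest is
    maximal. *)
Lemma exists_pe_maximal n (a : n.-tuple A) :
  exists b : n.-tuple A, pe_le a b /\ pe_maximal b.
Proof.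
have [I [g [gpe gP]]] := positive_existential_representatives n A_wo.
pose T (t : n.-tuple A) := [set i | `[< sat A t (g i) >]].
have TP (s t : n.-tuple A) : pe_le s t <-> T s \subset T t.
  split=> [st|/fintype.subsetP Tst phi /gP[i giE] /giE si].
    by apply/fintype.subsetP => i; rewrite !inE; exact: st.
  by apply/giE; have := Tst i; rewrite !inE; apply.
pose p k := `[< exists2 b : n.-tuple A, pe_le a b & #|T b| = k >].
have [|k|k /asboolP[b ab <-] kmax] := @ex_maxnP p #|I|.
- by exists #|T a|; apply/asboolP; exists a.
- by move=> /asboolP[b _ <-]; exact: max_card.
exists b; split=> // c /[dup] bc /TP Tbc; apply/TP.
have /eqP -> // : T b == T c.
rewrite eqEcard Tbc; apply: kmax; apply/asboolP; exists c => //.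
exact: (pe_le_trans ab bc).
Qed.

(** A maximal [b] above [(c, a)] has a tail above [a], hence also below it, so the head of [b] can
    be moved over [a] itself. *)
Lemma pe_maximal_extend n (a : n.-tuple A) (c : A) : pe_maximal a ->
  exists d, pe_maximal (cons_tuple d a) /\ pe_le (cons_tuple c a) (cons_tuple d a).
Proof.
move=> amax; have [b [cab bmax]] := exists_pe_maximal (cons_tuple c a).
have bE : b = cons_tuple (thead b) (behead_tuple b : n.-tuple A) by exact: tuple_eta.
rewrite bE in cab bmax.
have [d dP] := pe_le_extend (thead b) (amax _ (pe_le_tail cab)).
exists d; split; first exact: (pe_maximal_le dP bmax).
exact: (pe_le_trans cab dP).
Qed.

(** If [b] is above the subtuple, prolong it by some [d] above [a]; equality atoms force [b] to be
    the same subtuple of [d], and [d] is below [a]. *)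
Lemma pe_maximal_subtuple n m (a : m.-tuple A) (rho : 'I_n -> 'I_m) :
  pe_maximal a -> pe_maximal (subtuple a rho).
Proof.
move=> amax b /(@pe_le_extend_tuple _ _ _ m a)[d adP].
have bE : b = subtuple d rho.
  apply: eq_from_tnth => i; rewrite tnth_subtuple.
  have := adP (FEq L (rshift m i) (lshift n (rho i))) isT.
  by rewrite /= !tnth_rshift !tnth_lshift tnth_subtuple => ->.
have ad : pe_le a d.
  have E (t : m.-tuple A) (s : n.-tuple A) : t = subtuple (cat_tuple t s) (lshift n).
    by apply: eq_from_tnth => i; rewrite tnth_subtuple tnth_lshift.
  by rewrite (E a (subtuple a rho)) (E d b); exact: pe_le_subtuple.
by rewrite bE; apply/pe_le_subtuple/amax.
Qed.

Lemma exists_pe_generic_sequence :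
  countable_structure A -> A ->
  exists f : nat -> A, (forall n, pe_maximal (prefix f n)) /\
    forall x n, exists2 s, n <= s &
      pe_le (cons_tuple x (prefix f s)) (cons_tuple (f s) (prefix f s)).
Proof.
move=> cA a0; have [u us] := countable_enumeration a0 cA.
have [e eP] := recurrent_enumeration us.
have [f fP] := @dependent_choice_prefix A pe_maximal
  (fun n t d => pe_le (cons_tuple (e n) t) (cons_tuple d t))
  (fun b _ => ltac:(by rewrite [b]tuple0)) (fun n t => @pe_maximal_extend n t (e n)).
exists f; split=> [n|x n]; first by case: (fP n).
by have [s ns <-] := eP x n; exists s => //; case: (fP s).
Qed.

End WeaklyOligomorphic.

(** * Cores and their first-order definable relations *)

Definition substructure A (S : set A) : structure L :=
  @Structure L {x | S x} (fun r t => interp A r (map_tuple sval t)).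

Lemma embeds_substructure A (S : set A) : embeds (substructure S) A.
Proof.
exists sval; split=> [[x Sx] [y Sy] /= xy|//].
by move: xy Sy => <- Sy; congr exist; exact: Prop_irrelevance.
Qed.

Definition pe_core A (S : set A) :=
  (forall n (t : n.-tuple (substructure S)), pe_maximal (map_tuple sval t)) /\
  (forall n (t : n.-tuple (substructure S)) (x : A), exists d : substructure S,
    pe_le (cons_tuple x (map_tuple sval t)) (map_tuple sval (cons_tuple d t))).

(** Every tuple of the range is a subtuple of all long enough prefixes, and each [x] is imitated at
    arbitrarily late stages. *)
Lemma pe_core_range A (f : nat -> A) :
  weakly_oligomorphic A ->
  (forall n, pe_maximal (prefix f n)) ->
  (forall x n, exists2 s, n <= s &
      pe_le (cons_tuple x (prefix f s)) (cons_tuple (f s) (prefix f s))) ->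
  pe_core (fun x => exists k, f k = x).
Proof.
move=> A_wo fmax fext.
have sub n (t : n.-tuple (substructure (fun x => exists k, f k = x))) :
    exists m, forall s, m < s ->
      exists rho, map_tuple sval t = subtuple (prefix f s) rho.
  have /choice[k kP] (i : 'I_n) : exists k, f k = sval (tnth t i).
    by case: (tnth t i).
  exists (\max_i k i) => -[//|s] lts; exists (fun i => rev_ord (inord (k i))).
  apply: eq_from_tnth => i; rewrite tnth_map tnth_subtuple tnth_prefix_inord ?kP //.
  exact: leq_trans (leq_bigmax i) _.
split=> n t.
  have [m /(_ m.+1 (leqnn _))[rho ->]] := sub n t.
  exact: pe_maximal_subtuple.
move=> x; have [m mP] := sub n t; have [s /mP[rho tE] xs] := fext x m.+1.
exists (exist _ (f s) (ex_intro _ s erefl)).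
by rewrite map_cons_tuple tE -!subtuple_cons; exact: pe_le_subtuple.
Qed.

Section Core.
Variables (A : structure L) (S : set A).
Hypotheses (A_wo : weakly_oligomorphic A) (S_core : pe_core S).
Local Notation F := (substructure S).

Lemma core_extend n (a : n.-tuple A) (b : n.-tuple F) (c : A) :
  pe_le a (map_tuple sval b) ->
  exists d, pe_le (cons_tuple c a) (map_tuple sval (cons_tuple d b)).
Proof.
move=> /(pe_le_extend A_wo c)[x xP]; have [d dP] := S_core.2 n b x.
by exists d; exact: (pe_le_trans xP dP).
Qed.

Lemma core_homomorphism : countable_structure A -> A ->
  exists h : A -> F, homomorphism h.
Proof.
move=> cA a0; have [u us] := countable_enumeration a0 cA.
have [v vP] : exists v : nat -> F, forall n,
    pe_le (prefix u n) (map_tuple sval (prefix v n)) /\ True.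
  apply: (@dependent_choice_prefix F
    (fun n t => pe_le (prefix u n) (map_tuple sval t)) (fun _ _ _ => True)).
    by rewrite [map_tuple _ _]tuple0.
  by move=> n t /(core_extend (u n))[d dP]; exists d.
(* Types are compared in [A], not in [F], so the map is built into [A] and then corestricted. *)
have [h [hh hu]] : exists h : A -> A, homomorphism h /\ forall k, h (u k) = sval (v k).
  apply: homomorphism_of_prefixes => // n.
  by have [] := vP n; rewrite map_prefix.
have Sh x : S (h x) by have [k <-] := us x; rewrite hu; case: (v k).
exists (fun x => exist _ (h x) (Sh x)) => r t /hh /=.
by congr (interp A r _); apply: eq_from_tnth => i; rewrite !tnth_map.
Qed.

(** Types of tuples of a core are maximal, so the hypothesis is symmetric; this handles negation and
    the universal quantifier. *)
Lemma core_sat n (phi : formula L n) (a b : n.-tuple F) :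
  pe_le (map_tuple sval a) (map_tuple sval b) -> sat F a phi <-> sat F b phi.
Proof.
suff half : forall a b : n.-tuple F, pe_le (map_tuple sval a) (map_tuple sval b) ->
    sat F a phi -> sat F b phi.
  by move=> ab; split; apply: half => //; apply: S_core.1.
have inj : injective (sval : F -> A).
  by move=> [x Sx] [y Sy] /=; exact: eq_exist.
elim: phi => {n a b} /=.
- move=> n i j a b ab aij; apply: inj.
  by have := ab (FEq L i j) isT; rewrite /= !tnth_map aij; apply.
- move=> n r v a b ab.
  have E (t : n.-tuple F) : map_tuple sval (map_tuple (tnth t) v) =
      map_tuple (tnth (map_tuple sval t)) v.
    by apply: eq_from_tnth => i; rewrite !tnth_map.
  by rewrite !E; exact: (ab (FRel v) isT).
- by move=> n p IHp a b ab na /IHp-/(_ _ (S_core.1 _ _ _ ab)).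
- by move=> n p IHp q IHq a b ab [/(IHp _ _ ab)? /(IHq _ _ ab)].
- by move=> n p IHp q IHq a b ab [/(IHp _ _ ab)|/(IHq _ _ ab)]; [left|right].
- move=> n p IHp a b ab [c cP]; have [d dP] := core_extend (sval c) ab.
  by exists d; apply: IHp cP; rewrite map_cons_tuple.
- move=> n p IHp a b ab aP d.
  have [c cP] := core_extend (sval d) (S_core.1 _ _ _ ab).
  by apply: IHp (aP c); apply: S_core.1; rewrite map_cons_tuple.
Qed.

(** By [core_sat], truth in [F] depends only on the subset [V t] of a finite set, so each definable
    relation is some [W X]. *)
Lemma core_finitely_many_relations n :
  finite_set [set formula_relation F phi | phi in @setT (formula L n)]%classic.
Proof.
have [I [g [gpe gP]]] := positive_existential_representatives n A_wo.
pose V (t : n.-tuple F) := [set i | `[< sat A (map_tuple sval t) (g i) >]].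
have VP s t : V s = V t -> pe_le (map_tuple sval s) (map_tuple sval t).
  move=> /setP Vst phi /gP[i giE] /giE si; apply/giE.
  by have := Vst i; rewrite !inE (asboolT si) => /esym/asboolP.
pose W (X : {set {set I}}) : set (n.-tuple F) := fun t => V t \in X.
apply: (@sub_finite_set _ _ (range W)); last exact: finite_image.
move=> _ [phi _ <-].
exists [set v | `[< exists2 t, V t = v & sat F t phi >]] => //.
apply/funext => t; apply/propext; rewrite /W inE.
split=> [/asboolP[s /VP/core_sat->]|tphi] //.
by apply/asboolP; exists t.
Qed.

End Core.
End Formulas.

Theorem mainTheorem15 (L : signature) (A : structure L) :
  countable_structure A ->
  weakly_oligomorphic A ->
  exists F : structure L,
    [/\ homomorphism_equivalent A F,
        finite_structure F \/ omega_categorical F &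
        embeds F A].
Proof.
(* No sequence can be chosen in an empty [A], which is finite and serves as its own [F]. *)
move=> cA wo; have [[a0]|A0] := pselect (inhabited A); last first.
  have idE m (t : m.-tuple A) : map_tuple id t = t.
    by apply: eq_from_tnth => i; rewrite tnth_map.
  exists A; split; last by exists id; split=> // r t; rewrite idE.
    by split; exists id => r t; rewrite idE.
  by left; apply: (@sub_finite_set _ _ set0) => // x; case: A0.
have [f [fmax fext]] := exists_pe_generic_sequence wo cA a0.
have core := pe_core_range wo fmax fext.
set S := (fun x => _) in core.
exists (substructure S); split; last exact: embeds_substructure.
  split; first exact: core_homomorphism.
  by have [h [_ hP]] := embeds_substructure S; exists h => r t /hP.
have [fin|inf] := pselect (finite_set [set: substructure S]); first by left.
right; apply: omega_categorical_of_finitely_many_relations.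
  apply: eq_card_nat inf.
  pose u k : substructure S := exist _ (f k) (ex_intro _ k erefl).
  apply: (@sub_countable _ _ _ (range u)); last first.
    by apply: sub_countable (card_image_le _ _) _; exact: countableP.
  apply: subset_card_le => -[x [k fk]] _; exists k => //.
  exact: eq_exist.
exact: core_finitely_many_relations.
Qed.
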